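(* For all integers $q>t\geq 1$, $f_{1,t}(q,2)=\binom{qt+1}{t+1}$.
   Context: Let $q>t\geq s\geq 1$ and $k>1$ be integers. View a $q$-ary code $C$ of length $n$ (a set of words of length $n$ over an alphabet of size $q$) as an array whose rows are the distinct codewords and whose columns are the $n$ coordinates. $C$ is called a $(q,k,n)_{s,t}$-Armstrong code if (i) for any $t+1$ (distinct) rows of $C$, there are at most $k-1$ columns such that each of them has at most $s$ distinct entries in these $t+1$ rows; and (ii) for any $k-1$ columns of $C$, there exist $t+1$ (distinct) rows such that each of the $k-1$ columns has at most $s$ distinct entries in these $t+1$ rows and, further, there exists a column of $C$ having exactly $t+1$ distinct entries in these same $t+1$ rows. $f_{s,t}(q,k)$ denotes the maximum $n$ such that a $(q,k,n)_{s,t}$-Armstrong code exists. *)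

(* Defs.v *)
From mathcomp Require Import all_boot.

Set Implicit Arguments.
Unset Strict Implicit.
Unset Printing Implicit Defensive.

Section Armstrong.
Variables (q n : nat).
Implicit Types (C R : {set n.-tuple 'I_q}) (j : 'I_n).

Definition entries R j : {set 'I_q} := [set tnth r j | r in R].

(* A code is a set of words, so a subset R of it with #|R| = t.+1 is exactly a
   choice of t + 1 distinct rows.  The parameters are meant in the range
   1 <= s <= t < q and 1 < k. *)
Definition Armstrong (s t k : nat) C : Prop :=
  (forall R, R \subset C -> #|R| = t.+1 ->
     #|[set j | #|entries R j| <= s]| <= k - 1)
  /\
  (forall J : {set 'I_n}, #|J| = k - 1 ->
     exists R,
       [/\ R \subset C, #|R| = t.+1,
           forall j, j \in J -> #|entries R j| <= s
         & exists j, #|entries R j| = t.+1]).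

End Armstrong.

(* f_{s,t}(q,k) = m, as a relation: m is the largest length of a code.  This
   includes the claim that the maximum is attained. *)
Definition is_Armstrong_max (s t q k m : nat) : Prop :=
  (exists C : {set m.-tuple 'I_q}, Armstrong s t k C)
  /\
  (forall (n : nat) (C : {set n.-tuple 'I_q}), Armstrong s t k C -> n <= m).

(* Main.v *)
Require Import Defs.
From mathcomp Require Import all_boot.
From mathcomp Require Import zify.

(** Upper bound: among any [q * t + 1] rows every column is, by pigeonhole,
    constant on some [t + 1] of them, and condition (i) makes these
    [(t + 1)]-sets distinct for distinct columns.

    Lower bound: take [q * t + 1] rows and one column per [(t + 1)]-set [S],
    with colour classes [S] and [q - 1] further classes of size [t]; then [S] is
    the only [(t + 1)]-set on which this column is constant.  The relation
    [#|S :&: S'| = 1] is a regular graph on the [(t + 1)]-sets, so by Hall's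
    theorem it has a perfect matching; if [S] is matched to [S'], the classes of
    the column of [S'] can be chosen so that they separate the elements of [S]. *)

(** * Upper bound by pigeonhole *)

Lemma subset_of_card (T : finType) (A : {set T}) (k : nat) :
  k <= #|A| -> exists2 B : {set T}, B \subset A & #|B| = k.
Proof.
rewrite -bin_gt0 -cards_draws => /card_gt0P [B]; rewrite !inE.
by case/andP=> sBA /eqP cB; exists B.
Qed.

Lemma mono_subset_of_card (T : finType) (q t : nat) (g : T -> 'I_q)
    (D : {set T}) :
  q * t < #|D| ->
  exists R : {set T}, [/\ R \subset D, #|R| = t.+1 & #|g @: R| <= 1].
Proof.
move=> ltD.
have [a lta] : exists a, t < #|[set x in D | g x == a]|.
  apply/existsP; move: ltD; apply: contraTT => /existsPn le_t.
  rewrite -leqNgt -sum1_card (partition_big g predT) //=.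
  rewrite -[X in _ <= X * _](card_ord q) -sum_nat_const; apply: leq_sum => a _.
  by rewrite sum1dep_card leqNgt; apply: le_t.
have [R sR cR] := @subset_of_card _ _ t.+1 lta.
exists R; split => //.
  by apply: subset_trans sR _; apply/subsetP => x; rewrite inE => /andP [].
rewrite -(cards1 a); apply/subset_leq_card/subsetP => _ /imsetP [x xR ->].
by move/subsetP: sR => /(_ x xR); rewrite !inE => /andP [].
Qed.

Lemma Armstrong_length_le (q t n : nat) (C : {set n.-tuple 'I_q}) :
  Armstrong 1 t 2 C -> n <= 'C(q * t + 1, t + 1).
Proof.
rewrite !addn1; move=> [mono1 monoC].
(* All the chosen row sets must lie in one small [D]: the injection [f] then sends columns to
   [(t + 1)]-subsets of [D]. *)
suff [D leD monoD] : exists2 D : {set n.-tuple 'I_q}, #|D| <= (q * t).+1 &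
    forall j, exists R : {set n.-tuple 'I_q},
      [/\ R \subset D, R \subset C, #|R| = t.+1 & #|entries R j| <= 1].
  have [f fP] := fin_all_exists monoD.
  have f_inj : injective f.
    move=> j1 j2 eqf; have [_ sC cR m1] := fP j1; have [_ _ _ m2] := fP j2.
    have /card_le1_eqP := mono1 _ sC cR; apply; first by rewrite inE eqf.
    by rewrite inE.
  apply: leq_trans (leq_bin2l t.+1 leD); rewrite -cards_draws.
  rewrite -[leqLHS]card_ord -(card_imset _ f_inj).
  apply/subset_leq_card/subsetP => _ /imsetP [j _ ->].
  by have [sD _ cR _] := fP j; rewrite !inE cR eqxx sD.
have [ltC|leC] := ltnP (q * t) #|C|.
  have [D sDC cD] := @subset_of_card _ _ (q * t).+1 ltC.
  exists D => [|j]; first by rewrite cD.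
  have [|R [sRD cR mR]] := @mono_subset_of_card _ q t (fun r => tnth r j) D.
    by rewrite cD.
  by exists R; split=> //; apply: subset_trans sRD sDC.
exists C => [|j]; first exact: leqW.
have [|R [sRC cR mR _]] := monoC [set j]; first by rewrite cards1.
by exists R; split=> //; apply: mR; rewrite inE.
Qed.

(** * Hall's theorem and matchings in regular graphs *)

(* Rado's argument: in a family satisfying Hall's condition, a member with two
   elements can always lose one of them; otherwise the two violating index sets
   contradict the submodularity of [J |-> #|\bigcup_(i in J) A i|]. *)
Theorem Hall_marriage (I T : finType) (A : I -> {set T}) :
  (forall J : {set I}, #|J| <= #|\bigcup_(i in J) A i|) ->
  exists2 f : I -> T, injective f & forall i, f i \in A i.
Proof.
have [n] := ubnP (\sum_i #|A i|); elim: n A => // n IHn A ltA hallA.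
have [/existsP [i /card_gt1P [x [y [xA yA neq_xy]]]]|/existsPn le1] :=
  boolP [exists i, 1 < #|A i|].
- pose B z k := if k == i then A i :\ z else A k.
  have sBA z k : B z k \subset A k.
    by rewrite /B; case: eqP => [->|] //; apply: subD1set.
  (* If Hall's condition survives the deletion of [z] from [A i], induction on the total size
     applies. Otherwise a violating index set contains [i], as the other members are unchanged; [J]
     is this set without [i]. *)
  have shrink z : z \in A i ->
      (exists2 f : I -> T, injective f & forall k, f k \in A k) \/
      exists2 J : {set I}, i \notin J &
        #|(\bigcup_(k in J) A k) :|: (A i :\ z)| <= #|J|.
    move=> zA.
    have [/forallP hallB|/forallPn [J]] :=
      boolP [forall J : {set I}, #|J| <= #|\bigcup_(k in J) B z k|].
      left; have [|//|f f_inj fB] := IHn (B z).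
        apply: leq_trans (ltA : _ <= n).
        rewrite (bigD1 i) //= [X in _ < X](bigD1 i) //= -addSn.
        apply: leq_add; last by apply: leq_sum => k _; apply: subset_leq_card.
        by rewrite /B eqxx [X in _ < X](cardsD1 z) zA.
      by exists f => // k; apply: (subsetP (sBA z k)).
    rewrite -ltnNge => ltJ; right.
    have restA (K : {set I}) : i \notin K ->
        \bigcup_(k in K) B z k = \bigcup_(k in K) A k.
      move=> iK; apply: eq_bigr => k kK; rewrite /B.
      by case: eqP kK iK => [-> ->|].
    have iJ : i \in J.
      by apply: contraLR ltJ => iJ; rewrite -leqNgt restA.
    exists (J :\ i); first by rewrite !inE eqxx.
    move: ltJ; rewrite (cardsD1 i J) iJ ltnS (big_setD1 i iJ) /=.
    by rewrite restA ?setD11 // setUC {1}/B eqxx.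
  have [//|[J iJ leJ]] := shrink x xA.
  have [//|[K iK leK]] := shrink y yA.
  exfalso; move: leJ leK.
  set P := _ :|: _; set Q := _ :|: _ => leP leQ.
  (* Since [x] and [y] differ, [A i :\ x] and [A i :\ y] together cover [A i], so the index [i]
     counts here as well. *)
  have leU : #|J :|: K|.+1 <= #|P :|: Q|.
    have -> : #|J :|: K|.+1 = #|i |: (J :|: K)|.
      by rewrite cardsU1 !inE negb_or iJ iK.
    apply: leq_trans (hallA _) (subset_leq_card _).
    apply/bigcupsP => k; rewrite !inE => /or3P [/eqP ->|kJ|kK].
    + apply/subsetP => z zA; rewrite !inE zA !andbT.
      have [->|_] := eqVneq z x; last by rewrite orbT.
      by rewrite neq_xy !orbT.
    + by rewrite -setUA subsetU // bigcup_sup.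
    + by rewrite setUC -setUA subsetU // bigcup_sup.
  have leI : #|J :&: K| <= #|P :&: Q|.
    apply: leq_trans (hallA _) (subset_leq_card _).
    apply/bigcupsP => k; rewrite !inE => /andP [kJ kK].
    by rewrite subsetI !subsetU // bigcup_sup.
  have := cardsUI J K; have := cardsUI P Q; lia.
- have A_gt0 i : exists x, x \in A i.
    apply/card_gt0P; have := hallA [set i].
    by rewrite big_set1 cards1.
  have [f fA] := fin_all_exists A_gt0; exists f => // i j eq_f.
  apply/eqP; apply: contraT => neq_ij.
  have := hallA [set i; j]; rewrite cards2 neq_ij /= big_setU1 ?inE //=.
  rewrite big_set1.
  have A1 k : A k = [set f k].
    by apply/eqP; rewrite eq_sym eqEcard sub1set fA cards1 leqNgt le1.
  by rewrite !A1 eq_f setUid cards1.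
Qed.

(** Double counting gives Hall's condition: [d * #|J|] edges leave [J], and each vertex of the
    neighbourhood [N] receives at most [d] of them. *)
Lemma regular_matching (T : finType) (e : rel T) (d : nat) :
  symmetric e -> 0 < d -> (forall x, #|[set y | e x y]| = d) ->
  exists2 f : T -> T, injective f & forall x, e x (f x).
Proof.
move=> sym_e d_gt0 deg.
have [J|f f_inj fe] := @Hall_marriage _ _ (fun x => [set y | e x y]).
  set N := \bigcup_(_ in _) _; rewrite -(leq_pmul2r d_gt0).
  rewrite -[leqLHS]sum_nat_const -[leqRHS]sum_nat_const.
  have -> : \sum_(x in J) d = \sum_(x in J) \sum_(y in N | e x y) 1.
    apply: eq_bigr => x xJ; rewrite -(deg x) sum1dep_card; apply: eq_card => y.
    rewrite !inE; case exy: (e x y); rewrite ?andbF // andbT.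
    by apply/esym/bigcupP; exists x; rewrite // inE.
  rewrite (exchange_big_dep (mem N)) /=; last by move=> x y _ /andP [].
  apply: leq_sum => y _; rewrite -(deg y) sum1dep_card.
  apply/subset_leq_card/subsetP => x.
  by rewrite !inE sym_e => /andP [_ /andP []].
by exists f => // x; have := fe x; rewrite inE.
Qed.

(** * Regularity of the graph on [(t + 1)]-sets, and the colouring of one column *)

(** Such an [R] amounts to its common point with [S] and [t] points outside [S]. The count depends
    only on the size of [S], which makes the graph regular. *)
Lemma card_draws_meet1 (T : finType) (S : {set T}) (t : nat) :
  #|[set R : {set T} | (#|R| == t.+1) && (#|S :&: R| == 1)]|
  = #|S| * 'C(#|~: S|, t).
Proof.
pose P := setX S [set B : {set T} | B \subset ~: S & #|B| == t].
pose h (p : T * {set T}) := p.1 |: p.2.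
have PP x B : (x, B) \in P -> [/\ x \in S, B \subset ~: S, #|B| = t,
    S :&: h (x, B) = [set x] & h (x, B) :\: S = B].
  rewrite !inE /= => /andP [xS /andP [sB /eqP cB]]; split => //.
    apply/setP => y; rewrite /h !inE /=; case: eqP => [->|_] /=.
      by rewrite xS.
    apply/negP => /andP [yS yB]; move/subsetP: sB => /(_ y yB).
    by rewrite inE yS.
  apply/setP => y; rewrite /h !inE /=; case: eqP => [->|_] /=.
    by rewrite xS; apply/esym/negP => /(subsetP sB); rewrite inE xS.
  apply/andP/idP => [[]//|yB]; split=> //.
  by move/subsetP: sB => /(_ y yB); rewrite inE.
have h_inj : {in P &, injective h}.
  move=> [x B] [y D] /PP [_ _ _ m1 d1] /PP [_ _ _ m2 d2] eqh.
  rewrite eqh in m1 d1; rewrite -d1 d2; congr (_, _).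
  by apply/set1P; rewrite -m2 m1 inE.
rewrite -cards_draws -cardsX -/P -(card_in_imset h_inj).
apply: eq_card => R; rewrite !inE; apply/andP/imsetP => [[/eqP cR]|[]].
  case/cards1P => x SRx; exists (x, R :\: S).
    have : x \in S :&: R by rewrite SRx inE.
    rewrite !inE => /andP [xS xR]; rewrite xS /= setDE subsetIr /=.
    by have := cardsID S R; rewrite cR setIC SRx cards1 setDE add1n => -[->].
  by rewrite /h /= -SRx [S :&: R]setIC setID.
move=> [x B] xB ->; have [xS sB cB -> _] := PP _ _ xB.
rewrite cards1 /h cardsU1 cB; split => //.
suff -> : x \notin B by [].
by apply: contraL xS => /(subsetP sB); rewrite inE.
Qed.

(* The elements outside [S'] are coloured cyclically with the [q - 1] nonzero
   colours, starting with those of [S]. *)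
Lemma separating_coloring (T : finType) (q t : nat) (S S' : {set T}) :
  t < q -> #|T| = q * t + 1 -> #|S| = t.+1 -> #|S'| = t.+1 ->
  #|S :&: S'| = 1 ->
  exists c : T -> 'I_q,
    [/\ #|c @: S'| <= 1,
        forall R : {set T}, #|R| = t.+1 -> #|c @: R| <= 1 -> R = S'
      & {in S &, injective c}].
Proof.
case: q => // p; rewrite ltnS => le_tp cT cS cS' cSS'.
pose s := enum (S :\: S') ++ enum (~: (S :|: S')).
have cD : #|S :\: S'| = t by have := cardsID S' S; lia.
have mem_s x : (x \in s) = (x \notin S').
  rewrite mem_cat !mem_enum !inE; by case: (x \in S); case: (x \in S').
(* Outside [S'] there are [q * t + 1 - (t + 1)] points, so each of the [p] nonzero colours is used
   exactly [t] times. *)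
have size_s : size s = p * t.
  rewrite size_cat -!cardE; have := cardsC (S :|: S').
  have := cardsUI S S'; rewrite cT; lia.
have s_inj x y : x \notin S' -> y \notin S' -> index x s = index y s -> x = y.
  by rewrite -!mem_s; apply: index_inj.
have p_gt0 x : x \notin S' -> 0 < p.
  rewrite -mem_s; case: (p) size_s => // /size0nil ->; by rewrite in_nil.
pose c x : 'I_p.+1 := if x \in S' then ord0 else inord (index x s %% p).+1.
have c0 x : x \in S' -> c x = ord0 by rewrite /c => ->.
have c1 x : x \notin S' -> val (c x) = (index x s %% p).+1.
  move=> xS'; rewrite /c (negPf xS') /= inordK // ltnS ltn_mod.
  exact: p_gt0 xS'.
exists c; split.
- rewrite -(cards1 (ord0 : 'I_p.+1)); apply/subset_leq_card/subsetP.
  by move=> _ /imsetP [x xS' ->]; rewrite c0 // inE.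
(* If [R] leaves [S'], its colour is nonzero and its indices agree modulo [p]; the quotients by [p],
   all below [t], then tell its [t + 1] points apart. *)
- move=> R cR /card_le1_eqP mono.
  have {}mono x y : x \in R -> y \in R -> c x = c y.
    by move=> xR yR; apply: mono; apply: imset_f.
  case: (boolP (R \subset S')).
    by move=> sRS'; apply/eqP; rewrite eqEcard sRS' cR cS' leqnn.
  case/subsetPn => x xR xS'; exfalso.
  have RS' y : y \in R -> y \notin S'.
    move=> yR; apply/negP => /c0 cy; have := c1 _ xS'.
    by rewrite (mono x y) // cy.
  have q_lt y : y \in R -> index y s %/ p < t.
    move=> yR; rewrite ltn_divLR ?(p_gt0 x) // mulnC -size_s index_mem mem_s.
    exact: RS'.
  (* The case [t = 0] is split off because [inord] needs an inhabited ordinal type. *)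
  case: t cR q_lt {le_tp cT cS cS' cD size_s} => [|t] cR q_lt.
    by have := q_lt _ xR.
  pose h y : 'I_t.+1 := inord (index y s %/ p).
  have h_inj : {in R &, injective h}.
    move=> y z yR zR /(congr1 val); rewrite /= !inordK ?q_lt // => eq_div.
    apply: (s_inj y z (RS' _ yR) (RS' _ zR)).
    rewrite (divn_eq (index y s) p) (divn_eq (index z s) p) eq_div.
    congr (_ + _); apply: succn_inj; rewrite -!c1 ?RS' //.
    by congr val; apply: mono.
  have := max_card (mem (h @: R)).
  by rewrite card_in_imset // cR card_ord ltnn.
(* The [t <= p] points of [S :\: S'] come first in [s], so their indices are not reduced modulo
   [p]. *)
- have idx x : x \in S -> x \notin S' -> index x s < p.
    move=> xS xS'; apply: leq_trans le_tp; rewrite -cD cardE.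
    have xD : x \in enum (S :\: S') by rewrite mem_enum !inE xS' xS.
    by rewrite index_cat xD index_mem.
  move=> x y xS yS eq_c.
  have [xS'|xS'] := boolP (x \in S'); have [yS'|yS'] := boolP (y \in S').
  + have /card_le1_eqP : #|S :&: S'| <= 1 by rewrite cSS'.
    by apply; rewrite inE ?xS ?yS.
  + by have := c1 _ yS'; rewrite -eq_c c0.
  + by have := c1 _ xS'; rewrite eq_c c0.
  + apply: (s_inj x y xS' yS'); apply: succn_inj.
    have := c1 _ xS'; rewrite eq_c c1 //.
    by rewrite !modn_small ?idx.
Qed.

(** * The code attaining the bound *)

Lemma Armstrong_code_exists (q t : nat) : 1 <= t -> t < q ->
  exists C : {set 'C(q * t + 1, t + 1).-tuple 'I_q}, Armstrong 1 t 2 C.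
Proof.
move=> ht hq; pose T : finType := 'I_(q * t + 1).
have cT : #|T| = q * t + 1 by rewrite card_ord.
pose I : finType := {S : {set T} | #|S| == t.+1}.
have cI : #|I| = 'C(q * t + 1, t + 1).
  rewrite card_sig -cT addn1 -cardsT -cards_draws -cardsE.
  by apply: eq_card => S; rewrite !inE subsetT.
have valI (S : I) : #|val S| = t.+1 by apply/eqP/(valP S).
pose e (S R : I) := #|val S :&: val R| == 1.
have [||S|f f_inj fe] := @regular_matching _ e (t.+1 * 'C(q * t - t, t)).
- by move=> S R; rewrite /e setIC.
- by rewrite muln_gt0 /= bin_gt0; nia.
- have -> : q * t - t = #|~: val S|.
    by have := cardsC (val S); rewrite cT valI; lia.
  rewrite -[X in X * _](valI S) -card_draws_meet1 -(card_imset _ val_inj).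
  apply: eq_card => R; rewrite inE; apply/imsetP/andP.
    by case=> R' ; rewrite inE => eR ->; rewrite valI.
  case=> cR eR; exists (Sub R cR : I); last by rewrite SubK.
  by rewrite inE /e SubK.
(* Column [S] is to separate [g S]; equivalently, column [f S] separates [S]. *)
have [g gK fK] := injF_bij f_inj.
have c_ex (S : I) : exists c : T -> 'I_q,
    [/\ #|c @: val S| <= 1,
        forall R : {set T}, #|R| = t.+1 -> #|c @: R| <= 1 -> R = val S
      & {in val (g S) &, injective c}].
  apply: (@separating_coloring _ _ t) => //.
  by have /eqP := fe (g S); rewrite fK.
have [c cP] := fin_all_exists c_ex.
rewrite -cI; pose row x := [tuple c (enum_val j) x | j < #|I|].
have rowE x S : tnth (row x) (enum_rank S) = c S x.
  by rewrite tnth_mktuple enum_rankK.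
have row_inj : injective row.
  move=> x y eq_row; apply/eqP; apply: contraT => neq_xy.
  have c2 : #|[set x; y]| = 2 by rewrite cards2 neq_xy.
  (* As [t >= 1], two points extend by [t - 1] others to a [(t + 1)]-set [S], and column [f S] tells
     them apart. *)
  have [|B sB cB] := @subset_of_card _ (~: [set x; y]) t.-1.
    by have := cardsC [set x; y]; rewrite cT c2; nia.
  have cS : #|[set x; y] :|: B| == t.+1.
    have : #|[set x; y] :&: B| = 0.
      by apply/eqP; rewrite cards_eq0 setI_eq0 disjoint_sym disjoints_subset.
    have := cardsUI [set x; y] B; rewrite cB c2; lia.
  pose S : I := Sub ([set x; y] :|: B) cS.
  have [_ _ sep] := cP (f S); rewrite -(negbTE neq_xy); apply/eqP; apply: sep.
  + by rewrite gK SubK !inE eqxx.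
  + by rewrite gK SubK !inE eqxx orbT.
  + by rewrite -!rowE eq_row.
have entriesE (S : {set T}) (j : 'I_#|I|) :
    entries (row @: S) j = c (enum_val j) @: S.
  rewrite /entries -imset_comp; apply: eq_imset => x /=.
  by rewrite tnth_mktuple.
exists (row @: setT); split.
- move=> R sR cR.
  have [S _ defR] : exists2 S : {set T}, S \subset setT & R = row @: S.
    exists (row @^-1: R); first exact: subsetT.
    apply/setP => r; apply/idP/imsetP => [rR|[x]]; last by rewrite inE => ? ->.
    have /imsetP [x _ r_x] := subsetP sR r rR.
    by exists x; rewrite // inE -r_x.
  rewrite {R sR}defR card_imset // in cR *.
  (* Two columns constant on the rows of [S] are both indexed by [S]. *)
  apply/card_le1_eqP => j1 j2; rewrite !inE !entriesE => m1 m2.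
  apply/enum_val_inj/val_inj.
  have [_ /(_ S cR m1) <- _] := cP (enum_val j1).
  by have [_ /(_ S cR m2) <- _] := cP (enum_val j2).
- move=> J /eqP; rewrite subn1 /= => /cards1P [j ->].
  pose S := enum_val j; exists (row @: val S); split.
  + by apply: imsetS; apply: subsetT.
  + by rewrite card_imset.
  + by move=> i /set1P ->; rewrite entriesE; have [] := cP S.
  + exists (enum_rank (f S)); rewrite entriesE enum_rankK.
    by have [_ _ sep] := cP (f S); rewrite gK in sep; rewrite card_in_imset.
Qed.

Theorem proposition10 (q t : nat) (ht : 1 <= t) (hq : t < q) :
  is_Armstrong_max 1 t q 2 'C(q * t + 1, t + 1).
Proof.
split; first exact: Armstrong_code_exists.
by move=> n C; apply: Armstrong_length_le.
Qed.
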